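(* For any $\epsilon<1$ and any $n=\Omega\big((\frac{1}{\epsilon})^{\Theta(1/\epsilon)}\big)$, there is an $n$-vertex edge-weighted graph $G$ of treewidth at most $4$ such that every $(1+\epsilon)$-spanner of $G$ has lightness $\Omega(\frac{1}{\epsilon^2})$.
   Context: A $(1+\epsilon)$-spanner of an edge-weighted graph $G$ is a spanning subgraph $H$ with $d_H(u,v)\leq(1+\epsilon)d_G(u,v)$ for all vertices $u,v$; its lightness is $w(H)/w(\mathrm{MST}(G))$, where $w(H)$ is the total edge weight of $H$ and $\mathrm{MST}(G)$ is a minimum spanning tree of $G$. *)

(* Defs.v *)
From HB Require Import structures.
From mathcomp Require Import all_boot all_order all_algebra.
From mathcomp Require Import boolp classical_sets reals constructive_ereal ereal exp.

Set Implicit Arguments.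
Unset Strict Implicit.
Unset Printing Implicit Defensive.

Import Order.TTheory GRing.Theory Num.Theory.

Local Open Scope ring_scope.

Section EdgeSets.
Variable V : finType.

(* A simple graph on V is given by its set of edges, each edge being a
   two-element subset of V. *)
Definition edge_set (E : {set {set V}}) : Prop :=
  forall e, e \in E -> #|e| = 2%N.

Definition edge (x y : V) : {set V} := [set x; y]%SET.

Definition adj (E : {set {set V}}) : rel V := fun x y => edge x y \in E.

Definition connected (E : {set {set V}}) : Prop :=
  forall x y, connect (adj E) x y.

Definition acyclic (E : {set {set V}}) : Prop :=
  forall c : seq V, (2 < size c)%N -> ~ ucycle (adj E) c.

Definition tree (E : {set {set V}}) : Prop :=
  [/\ edge_set E, connected E & acyclic E].

End EdgeSets.

Section TreeDecomposition.
Variables (V : finType) (E : {set {set V}}).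

Record tree_decomposition (I : finType) (F : {set {set I}})
    (B : I -> {set V}) : Prop := TreeDecomposition {
  td_tree : tree F;
  td_vertex : forall v, exists i, v \in B i;
  td_edge : forall e, e \in E -> exists i, e \subset B i;
  td_subtree : forall v i j, v \in B i -> v \in B j ->
    connect [rel a b | [&& adj F a b, v \in B a & v \in B b]] i j }.

Definition width (I : finType) (B : I -> {set V}) : nat :=
  (\max_(i : I) #|B i|).-1.

Definition has_width (k : nat) : Prop :=
  exists (I : finType) (F : {set {set I}}) (B : I -> {set V}),
    tree_decomposition F B /\ width B = k.

Lemma has_width_ex : exists k, `[< has_width k >].
Proof.
exists (width (fun _ : unit => [set: V]%SET)); apply/asboolP.
exists unit, finset.set0, (fun=> [set: V]%SET); split=> //; split.
- split=> [e|x y|[|x [|y c]] //].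
  + by rewrite inE.
  + by case: x; case: y; apply: connect0.
  + by case: x; case: y => _ /andP[].
- by move=> v; exists tt; rewrite inE.
- by move=> e _; exists tt; apply: finset.subsetT.
- by move=> v [] [] _ _; apply: connect0.
Qed.

Definition treewidth : nat := ex_minn has_width_ex.

End TreeDecomposition.

Record wgraph (R : realType) (V : finType) := WGraph {
  edges : {set {set V}};
  wt : {set V} -> R;
  edges_simple : edge_set edges;
  wt_gt0 : forall e, e \in edges -> 0 < wt e }.

Section WeightedGraphs.
Variables (R : realType) (V : finType) (G : wgraph R V).

(* Spanning subgraphs of G are identified with subsets of its edge set. *)

Definition weight (H : {set {set V}}) : R := \sum_(e in H) wt G e.

(* The walk x :: p, in the representation used by [path]. *)
Definition walk_weight (x : V) (p : seq V) : R :=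
  \sum_(e <- pairmap (@edge V) x p) wt G e.

(* The infimum is over all walks from x to y in H; it is +oo if there are
   none. *)
Definition dist (H : {set {set V}}) (x y : V) : \bar R :=
  ereal_inf [set (walk_weight x p)%:E |
              p in [set p | path (adj H) x p && (last x p == y)]]%classic.

Definition spanner (eps : R) (H : {set {set V}}) : Prop :=
  H \subset edges G /\
  forall x y, (dist H x y <= (1 + eps)%:E * dist (edges G) x y)%E.

Definition spanning_tree (M : {set {set V}}) : Prop :=
  M \subset edges G /\ tree M.

Definition minimum_spanning_tree (M : {set {set V}}) : Prop :=
  spanning_tree M /\ forall M', spanning_tree M' -> weight M <= weight M'.

(* M stands for a minimum spanning tree of G: the value does not depend on
   which one is chosen. *)
Definition lightness (M H : {set {set V}}) : R := weight H / weight M.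

End WeightedGraphs.

(* Main.v *)
(* With q = 2m and m close to 1/eps, take the path 0, 1, ..., n-1 with unit
   edges and, for j < J with J close to 1/(2 eps), add the level j chords
   (x, x + m q^j), where x runs over the first m division points of each block
   [b q^(j+1), (b+1) q^(j+1)]. A level j chord has weight its span times
   1/(1 + 2 eps (j+1)), a factor which decreases slowly enough to stay above 1/3
   and fast enough that a detour using lower levels only costs more than 1 + eps
   times the chord. A detour through a parallel chord travels at least 2 q^j
   more, which is again too long since q^j is about eps times the span of the
   chord; chords of higher levels are at least twice as heavy. Hence a spanner
   contains all the chords. Each level has total weight of order n m and the
   minimum spanning tree is the path, so the lightness is of order J m. Each
   block is a ladder with one more edge, refined recursively along its path
   edges, which gives a tree decomposition with bags of size at most 5. *)
Require Import Defs.
From HB Require Import structures.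
From mathcomp Require Import all_boot all_order all_algebra.
From mathcomp Require Import boolp classical_sets reals constructive_ereal ereal exp.
From mathcomp Require Import zify ring lra.

Set Implicit Arguments.
Unset Strict Implicit.
Unset Printing Implicit Defensive.

Import Order.TTheory GRing.Theory Num.Theory.

Local Open Scope ring_scope.

(** * Unordered pairs, and rooted trees given by a parent function *)

Lemma edgeC (V : finType) (x y : V) : edge x y = edge y x.
Proof. by rewrite /edge finset.setUC. Qed.

Lemma eq_edge (V : finType) (x y a b : V) :
  edge x y = edge a b -> (x = a /\ y = b) \/ (x = b /\ y = a).
Proof.
move=> h.
have hx : x \in edge a b by rewrite -h !inE eqxx.
have hy : y \in edge a b by rewrite -h !inE eqxx orbT.
have ha : a \in edge x y by rewrite h !inE eqxx.
have hb : b \in edge x y by rewrite h !inE eqxx orbT.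
move: hx hy ha hb; rewrite !inE.
case/orP=> /eqP ->; case/orP=> /eqP ->; rewrite ?orbb => /eqP ? /eqP ?; subst; auto.
Qed.

Lemma adjC (V : finType) (E : {set {set V}}) : symmetric (adj E).
Proof. by move=> x y; rewrite /adj edgeC. Qed.

Definition parent_edges (I : finType) (p : I -> I) (root : I) : {set {set I}} :=
  [set edge i (p i) | i in [set~ root]]%SET.

Section ParentTree.
Variables (I : finType) (p : I -> I) (r : I -> nat) (root : I).
Hypothesis p_lt : forall i, i != root -> (r (p i) < r i)%N.

Let F := parent_edges p root.

Lemma adj_parent i : i != root -> adj F i (p i).
Proof. by move=> hi; apply/imsetP; exists i; rewrite ?inE. Qed.

Lemma adj_parentP x y : adj F x y -> (r y <= r x)%N -> y = p x.
Proof.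
case/imsetP=> i; rewrite !inE => /p_lt hi /eq_edge[[-> ->]//|[-> ->]] /=.
by rewrite leqNgt hi.
Qed.

Lemma parent_ind (P : I -> Prop) :
  P root -> (forall i, i != root -> P (p i) -> P i) -> forall i, P i.
Proof.
move=> P0 PS i; have [n] := ubnP (r i); elim: n i => // n IH i hi.
have [->//|ne] := eqVneq i root.
by apply: PS => //; apply: IH; apply: leq_trans (p_lt ne) _.
Qed.

Lemma parent_tree : tree F.
Proof.
split.
- move=> e /imsetP[i]; rewrite !inE => /p_lt hi ->.
  by rewrite cards2; case: eqP hi => // <-; rewrite ltnn.
- have h i : connect (adj F) i root.
    elim/parent_ind: i => [|i hi]; first exact: connect0.
    by apply: connect_trans; apply/connect1/adj_parent.
  by move=> x y; apply: connect_trans (h x) _; rewrite (sym_connect_sym (@adjC _ F)).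
- case=> // c0 c sz uc.
  (* At a vertex of maximal rank on a cycle both neighbours would be its parent, but on a cycle of
     length at least 3 they are distinct. *)
  pose x := [arg max_(x > c0 in c0 :: c) r x].
  have [xc xmax] : x \in c0 :: c /\ forall y, y \in c0 :: c -> (r y <= r x)%N.
    by rewrite /x; case: arg_maxnP => [|y yc ymax]; rewrite ?inE ?eqxx.
  have [k d ed] := rot_to xc.
  have : ucycle (adj F) (x :: d) by rewrite -ed rot_ucycle.
  have szd : (2 < size (x :: d))%N by rewrite -ed size_rot.
  have dmax y : y \in d -> (r y <= r x)%N.
    by move=> yd; apply: xmax; rewrite -(mem_rot k) ed inE yd orbT.
  case: d szd dmax {ed} => // y d; case/lastP: d => // d z _ dmax.
  rewrite /ucycle /= rcons_path last_rcons => /andP[/andP[xy /andP[_ zx]]].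
  rewrite adjC in zx.
  have yE : y = p x by apply: adj_parentP xy (dmax _ _); rewrite mem_head.
  have zE : z = p x.
    by apply: adj_parentP zx (dmax _ _); rewrite inE mem_rcons mem_head orbT.
  by rewrite /= yE zE mem_rcons mem_head andbF.
Qed.

End ParentTree.

(** * Treewidth bounds from a parent function and bags *)

Section TreewidthBound.
Variables (V : finType) (E : {set {set V}}) (I : finType).
Variables (p : I -> I) (r : I -> nat) (root : I) (B : I -> {set V}) (top : V -> I).
Hypothesis p_lt : forall i, i != root -> (r (p i) < r i)%N.
Hypothesis top_in : forall v, v \in B (top v).
Hypothesis B_parent :
  forall v i, v \in B i -> i != top v -> i != root /\ v \in B (p i).
Hypothesis edge_in : forall e, e \in E -> exists i, e \subset B i.

(** From any bag containing v, following parents stays in such bags until it reaches [top v]; hence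
    these bags form a subtree. *)
Lemma treewidth_parent k :
  (forall i, (#|B i| <= k.+1)%N) -> (treewidth E <= k)%N.
Proof.
move=> Bk; pose F := parent_edges p root.
have dec : tree_decomposition E F B.
  split=> //; first exact: parent_tree p_lt.
    by move=> v; exists (top v).
  move=> v; set e := [rel a b | _].
  have eC : symmetric e by move=> a b; rewrite /= adjC [in RHS]andbCA andbA andbAC -andbA andbCA.
  have h i : v \in B i -> connect e i (top v).
    elim/(parent_ind p_lt): i => [|i hi IH] vi.
      have [->|ne] := eqVneq root (top v); first exact: connect0.
      by have [/eqP] := B_parent vi ne.
    have [->|ne] := eqVneq i (top v); first exact: connect0.
    have [ir vp] := B_parent vi ne.
    by apply: connect_trans (IH vp); apply: connect1; rewrite /= adj_parent ?vi.
  move=> i j vi vj; apply: connect_trans (h i vi) _.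
  by rewrite (sym_connect_sym eC); apply: h.
have hw : has_width E (width B) by exists I, F, B.
rewrite /treewidth; case: ex_minnP => t _ tmin.
have wk : (width B <= k)%N.
  by rewrite /width -subn1 leq_subLR; apply/bigmax_leqP => i _.
by apply: leq_trans (tmin _ _) wk; apply/asboolP.
Qed.

End TreewidthBound.

(** Grow a vertex set from one vertex: each new vertex is reached by an edge leaving the current
    set, so it brings a new edge. This later bounds spanning trees from below. *)
Lemma connected_card (V : finType) (E : {set {set V}}) :
  Defs.connected E -> (#|V| <= #|E|.+1)%N.
Proof.
move=> Ec; have [->//|/card_gt0P[v0 _]] := posnP #|V|.
have grow k : (k < #|V|)%N -> exists A : {set V},
    [/\ #|A| = k.+1, v0 \in A & (k <= #|[set e in E | e \subset A]%SET|)%N].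
  elim: k => [_|k IH hk].
    by exists [set v0]%SET; rewrite cards1 inE eqxx.
  have [A [cA v0A hA]] := IH (ltnW hk).
  have [y yA] : exists y, y \notin A.
    apply/existsP; rewrite -negb_forall; apply: contraL hk => /forallP allA.
    by rewrite -leqNgt -cA; apply/subset_leq_card/fintype.subsetP.
  have [a [b [ab aA bA]]] : exists a b, [/\ adj E a b, a \in A & b \notin A].
    have /connectP[c cp yl] := Ec v0 y.
    elim: c v0 v0A cp yl {IH} => [|z c IHc] w wA /=; first by move=> _ yw; rewrite yw wA in yA.
    case/andP=> wz zp yl; have [zA|zA] := boolP (z \in A); first exact: IHc zA zp yl.
    by exists w, z.
  exists (b |: A)%SET; split.
  - by rewrite cardsU1 bA cA.
  - by rewrite !inE v0A orbT.
  - apply: leq_ltn_trans hA _; apply: proper_card; apply/properP; split.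
      apply/fintype.subsetP=> e; rewrite !inE => /andP[-> /= eA].
      exact: fintype.subset_trans eA (finset.subsetUr _ _).
    exists (edge a b); rewrite !inE.
      rewrite [_ \in E]ab; apply/fintype.subsetP=> z; rewrite !inE.
      by case/orP=> /eqP ->; rewrite ?eqxx ?aA ?orbT.
    apply/negP=> /andP[_ /fintype.subsetP/(_ b)]; rewrite !inE eqxx orbT (negPf bA).
    by move/(_ isT).
have [|A [_ _ hA]] := grow #|V|.-1; first by rewrite prednK //; apply/card_gt0P; exists v0.
rewrite -(leq_add2r 1) !addn1 in hA; apply: leq_trans (leqSpred _) (leq_trans hA _).
by rewrite ltnS; apply/subset_leq_card/fintype.subsetP => e; rewrite inE => /andP[].
Qed.

(** * Chords and elimination orderings *)

(* For y = x + m(2m)^j: the block of level j is cut into 2m parts of length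
   (2m)^j, and each division point of its first half is joined to the
   corresponding one of its second half. *)
Definition chord (m j x y : nat) : bool :=
  [&& ((2 * m) ^ j %| x)%N, ((x %/ (2 * m) ^ j) %% (2 * m) < m)%N
    & y == (x + m * (2 * m) ^ j)%N].

Lemma chord0 m x y : chord m 0 x y = (x %% (2 * m) < m)%N && (y == x + m)%N.
Proof. by rewrite /chord expn0 dvd1n divn1 muln1. Qed.

(** The chords of positive level form a copy of the whole chord system scaled by 2m, which allows an
    induction on the number of levels. *)
Lemma chordS m j x y : (0 < m)%N -> chord m j.+1 x y ->
  exists x' y', [/\ x = (x' * (2 * m))%N, y = (y' * (2 * m))%N & chord m j x' y'].
Proof.
move=> m0; rewrite /chord expnS; set q := (2 * m)%N.
have q0 : (0 < q)%N by rewrite muln_gt0.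
case/and3P=> /dvdnP[z ->] hz /eqP ->.
exists (z * q ^ j)%N, (z * q ^ j + m * q ^ j)%N.
split; first by rewrite mulnA mulnAC.
  by lia.
move: hz; rewrite dvdn_mull// !mulnK ?muln_gt0 ?expn_gt0 ?muln_gt0 ?m0//.
by move=> ->; rewrite eqxx.
Qed.

Definition host_rel (m J x y : nat) : bool :=
  (y == x.+1) || [exists j : 'I_J, chord m j x y].

(* An elimination ordering of [0, (2m)^L]: {x} and [S x], the neighbours of x
   in the fill-in that are eliminated after x, form the bag of x; [p] is the
   parent function of the decomposition tree and [r] decreases along it.
   [elim_edge] covers the pairs of consecutive integers, which makes the ends
   of every block adjacent when a block of the next level is refined. *)
Record elimination (m L : nat) (S : nat -> seq nat) (p r : nat -> nat) (K : nat) :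
    Prop := Elimination {
  elim_size : forall x, (size (S x) <= 4)%N;
  elim_root : S 0%N = [::];
  elim_parent_le : forall x, (0 < x <= (2 * m) ^ L)%N -> (p x <= (2 * m) ^ L)%N;
  elim_rank_lt : forall x, (0 < x <= (2 * m) ^ L)%N -> (r (p x) < r x)%N;
  elim_rank_bound : forall x, (x <= (2 * m) ^ L)%N -> (r x < K)%N;
  elim_clique : forall x u, (0 < x <= (2 * m) ^ L)%N -> u \in S x ->
    u = p x \/ u \in S (p x);
  elim_edge : forall x y, (y <= (2 * m) ^ L)%N ->
    y = x.+1 \/ (exists2 j, (j < L)%N & chord m j x y) -> (x \in S y) || (y \in S x) }.

(** * Refining an elimination ordering by one level *)

Section EliminationStep.
Variables (m L : nat) (S' : nat -> seq nat) (p' r' : nat -> nat) (K' : nat).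
Hypothesis m_gt1 : (1 < m)%N.
Hypothesis H : elimination m L S' p' r' K'.

Let q := (2 * m)%N.
Let q_gt0 : (0 < q)%N. Proof. by rewrite /q; lia. Qed.

(* In a block s, ..., t = s + q the reverse elimination
   order is s + m, s + 1, s + m + 1, s + 2, s + m + 2, ...: the ladder formed by the
   chords is swept from left to right, keeping s + m and t in all bags. *)
Definition elim_S x :=
  let b := (x %/ q)%N in let i := (x %% q)%N in
  if i == 0%N then [seq (u * q)%N | u <- S' b]
  else if i == m then [:: b * q; b.+1 * q]%N
  else if (i < m)%N then [:: x.-1; x.-1 + m; b * q + m; b.+1 * q]%N
  else [:: x - m; x.-1; b * q + m; b.+1 * q]%N.

(** The midpoint s + m hangs below the end of its block that the coarser ordering eliminates first,
    because the bag of that end contains the other end too. *)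
Definition elim_p x :=
  let b := (x %/ q)%N in let i := (x %% q)%N in
  if i == 0%N then (p' b * q)%N
  else if i == m then (if b \in S' b.+1 then b.+1 * q else b * q)%N
  else if (i < m)%N then (x.-1 + m)%N
  else (x - m)%N.

(** Coarser vertices keep their ranks, which are below [K']; inside a block the ranks start at [K']
    and grow along the reverse elimination order. Different blocks share ranks, as only comparisons
    with the parent matter. *)
Definition elim_r x :=
  let b := (x %/ q)%N in let i := (x %% q)%N in
  if i == 0%N then r' b
  else if i == m then K'
  else if (i < m)%N then (K' + (2 * i).-1)%N
  else (K' + 2 * (i - m))%N.

Let div_digit b i : (i < q)%N -> ((b * q + i) %/ q)%N = b.
Proof. by move=> iq; rewrite divnMDl// divn_small// addn0. Qed.

Let mod_digit b i : (i < q)%N -> ((b * q + i) %% q)%N = i.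
Proof. by move=> iq; rewrite modnMDl modn_small. Qed.

Lemma digitP x : exists b i, [/\ x = (b * q + i)%N & (i < q)%N].
Proof. by exists (x %/ q)%N, (x %% q)%N; rewrite ltn_mod -divn_eq. Qed.

Let m_lt_q : (m < q)%N. Proof. by rewrite /q; lia. Qed.

Lemma elim_S0 b : elim_S (b * q) = [seq (u * q)%N | u <- S' b].
Proof. by rewrite /elim_S modnMl mulnK. Qed.
Lemma elim_Sm b : elim_S (b * q + m) = [:: b * q; b.+1 * q]%N.
Proof. by rewrite /elim_S mod_digit// div_digit// eqxx; case: eqP => // m0; lia. Qed.
Lemma elim_Sl b i : (0 < i < m)%N ->
  elim_S (b * q + i) = [:: (b * q + i).-1; (b * q + i).-1 + m; b * q + m; b.+1 * q]%N.
Proof.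
case/andP=> i0 im; have iq := ltn_trans im m_lt_q.
by rewrite /elim_S mod_digit// div_digit// im (ltn_eqF im) eqn0Ngt i0.
Qed.
Lemma elim_Sr b i : (0 < i < m)%N ->
  elim_S (b * q + m + i) = [:: b * q + i; (b * q + m + i).-1; b * q + m; b.+1 * q]%N.
Proof.
case/andP=> i0 im; have iq : (m + i < q)%N by rewrite /q; lia.
rewrite -addnA /elim_S mod_digit// div_digit//.
by do 3 (case: ifP => ?; first lia); congr [:: _; _; _; _]; lia.
Qed.

Lemma elim_p0 b : elim_p (b * q) = (p' b * q)%N.
Proof. by rewrite /elim_p modnMl mulnK. Qed.
Lemma elim_pm b :
  elim_p (b * q + m) = (if b \in S' b.+1 then b.+1 * q else b * q)%N.
Proof. by rewrite /elim_p mod_digit// div_digit// eqxx; case: eqP => // m0; lia. Qed.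
Lemma elim_pl b i : (0 < i < m)%N -> elim_p (b * q + i) = ((b * q + i).-1 + m)%N.
Proof.
case/andP=> i0 im; have iq := ltn_trans im m_lt_q.
by rewrite /elim_p mod_digit// div_digit// im (ltn_eqF im) eqn0Ngt i0.
Qed.
Lemma elim_pr b i : (0 < i < m)%N -> elim_p (b * q + m + i) = (b * q + i)%N.
Proof.
case/andP=> i0 im; have iq : (m + i < q)%N by rewrite /q; lia.
rewrite -addnA /elim_p mod_digit// div_digit//.
by do 3 (case: ifP => ?; first lia); lia.
Qed.

Lemma elim_r0 b : elim_r (b * q) = r' b.
Proof. by rewrite /elim_r modnMl mulnK. Qed.
Lemma elim_rm b : elim_r (b * q + m) = K'.
Proof. by rewrite /elim_r mod_digit// eqxx; case: eqP => // m0; lia. Qed.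
Lemma elim_rl b i : (0 < i < m)%N -> elim_r (b * q + i) = (K' + (2 * i).-1)%N.
Proof.
case/andP=> i0 im; have iq := ltn_trans im m_lt_q.
by rewrite /elim_r mod_digit// im (ltn_eqF im) eqn0Ngt i0.
Qed.
Lemma elim_rr b i : (0 < i < m)%N -> elim_r (b * q + m + i) = (K' + 2 * i)%N.
Proof.
case/andP=> i0 im; have iq : (m + i < q)%N by rewrite /q; lia.
rewrite -addnA /elim_r mod_digit//.
by do 3 (case: ifP => ?; first lia); lia.
Qed.

Variant position_spec : nat -> Prop :=
| PosEnd b : position_spec (b * q)%N
| PosMid b : position_spec (b * q + m)%N
| PosLeft b i of (0 < i < m)%N : position_spec (b * q + i)%N
| PosRight b i of (0 < i < m)%N : position_spec (b * q + m + i)%N.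

Lemma positionP x : position_spec x.
Proof.
have [b [i [-> iq]]] := digitP x.
have [->|i0] := posnP i; first by rewrite addn0; constructor.
have [im|mi|->] := ltngtP i m; last by constructor.
- by constructor; rewrite i0.
- rewrite -(subnKC (ltnW mi)) addnA; constructor; move: iq; rewrite /q; lia.
Qed.

Lemma elimination_step : elimination m L.+1 elim_S elim_p elim_r (K' + 2 * q).
Proof.
have Q : ((2 * m) ^ L.+1 = (2 * m) ^ L * q)%N by rewrite expnS mulnC.
set N := ((2 * m) ^ L)%N in Q *.
have inner b i : (0 < i)%N -> (b * q + i <= N * q)%N -> (b.+1 <= N)%N.
  move=> i0 h; rewrite -(ltn_pmul2r q_gt0); apply: leq_trans h; lia.
have ble b : (b <= N)%N -> (b * q <= N * q)%N by move=> h; rewrite leq_mul2r h orbT.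
have qE : q = (2 * m)%N by [].
have step b : (b.+1 * q = b * q + q)%N by rewrite mulSn addnC.
split; rewrite ?Q.
- case/positionP=> *; rewrite ?elim_S0 ?elim_Sm ?elim_Sl ?elim_Sr//.
  by rewrite size_map (elim_size H).
- by rewrite -(mul0n q) elim_S0 (elim_root H).
- move=> x; case/positionP: x => [b|b|b i im|b i im] /andP[x0 xN].
  + rewrite elim_p0; apply: ble; apply: (elim_parent_le H).
    by rewrite -[(b <= _)%N](leq_pmul2r q_gt0) xN andbT; move: x0; rewrite muln_gt0 => /andP[].
  + have /ble bN := inner _ _ (ltnW m_gt1) xN.
    by rewrite elim_pm; case: ifP; lia.
  + have /ble bN : (b.+1 <= N)%N by apply: inner xN; lia.
    by rewrite elim_pl//; lia.
  + by rewrite elim_pr//; lia.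
- move=> x; case/positionP: x => [b|b|b i im|b i im] /andP[x0 xN].
  + rewrite elim_p0 !elim_r0; apply: (elim_rank_lt H).
    by rewrite -[(b <= _)%N](leq_pmul2r q_gt0) xN andbT; move: x0; rewrite muln_gt0 => /andP[].
  + have bN := inner _ _ (ltnW m_gt1) xN.
    by rewrite elim_pm elim_rm; case: ifP => _; rewrite elim_r0;
      apply: (elim_rank_bound H) => //; apply: ltnW.
  + rewrite elim_pl// elim_rl//.
    have [i1|i1] : i = 1%N \/ (1 < i)%N by lia.
      by rewrite i1 addn1 /= elim_rm; lia.
    have -> : ((b * q + i).-1 + m = b * q + m + i.-1)%N by lia.
    by rewrite elim_rr; lia.
  + by rewrite elim_pr// elim_rl// elim_rr//; lia.
- move=> x; case/positionP: x => [b|b|b i im|b i im] xN.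
  + rewrite elim_r0; apply: ltn_addr; apply: (elim_rank_bound H).
    by rewrite -(leq_pmul2r q_gt0).
  + by rewrite elim_rm; lia.
  + by rewrite elim_rl//; lia.
  + by rewrite elim_rr//; lia.
- move=> x u; case/positionP: x => [b|b|b i im|b i im] /andP[x0 xN].
  + rewrite elim_S0 elim_p0 elim_S0 => /mapP[v vb ->].
    have bN : (0 < b <= N)%N.
      by rewrite -[(b <= _)%N](leq_pmul2r q_gt0) xN andbT; move: x0; rewrite muln_gt0 => /andP[].
    by have [->|vp] := elim_clique H bN vb; [left | right; apply: map_f].
  + have bN := inner _ _ (ltnW m_gt1) xN.
    (* The ends of the block are consecutive in the coarser ordering, so one of them lies in the bag
       of the other. *)
    have := elim_edge H bN (or_introl (erefl _)).
    rewrite elim_Sm elim_pm; case: ifP => [hb _|_ /= hb].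
      rewrite elim_S0 !inE => /orP[] /eqP ->; [right | by left].
      exact: map_f hb.
    rewrite elim_S0 !inE => /orP[] /eqP ->; [by left | right].
    exact: map_f hb.
  + rewrite elim_Sl// elim_pl//.
    (* For i = 1 the parent is the midpoint, otherwise it is the right end of the previous rung. *)
    have [i1|i1] : i = 1%N \/ (1 < i)%N by lia.
      rewrite i1 addn1 /= elim_Sm !inE.
      by case/or4P=> /eqP ->; rewrite ?eqxx ?orbT; auto.
    have -> : ((b * q + i).-1 + m = b * q + m + i.-1)%N by lia.
    rewrite elim_Sr; last by lia.
    have -> : ((b * q + i).-1 = b * q + i.-1)%N by lia.
    by rewrite !inE => /or4P[] /eqP ->; rewrite ?eqxx ?orbT; auto.
  + rewrite elim_Sr// elim_pr// elim_Sl//.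
    have -> : ((b * q + i).-1 + m = (b * q + m + i).-1)%N by lia.
    by rewrite !inE => /or4P[] /eqP ->; rewrite ?eqxx ?orbT; auto.
- move=> x y yN [yx|[j jL c]]; last first.
    (* Chords of positive level come from the coarser ordering by scaling; those of level 0 are the
       rungs of a block. *)
    case: j jL c => [_|j jL /(chordS (ltnW m_gt1))[x' [y' [xE yE c]]]]; last first.
      have yN' : (y' <= N)%N by rewrite yE leq_pmul2r in yN.
      rewrite xE yE !elim_S0.
      have /orP[h|h] := elim_edge H yN' (or_intror (ex_intro2 _ _ j jL c)).
        by apply/orP; left; apply: map_f h.
      by apply/orP; right; apply: map_f h.
    rewrite chord0 -/q => /andP[xm /eqP ->].
    case/positionP: x xm {yN} => [b|b|b i im|b i im] xm.
    * by rewrite elim_Sm !inE eqxx.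
    * by rewrite mod_digit ?ltnn in xm.
    * have -> : (b * q + i + m = b * q + m + i)%N by lia.
      by rewrite elim_Sr// !inE eqxx.
    * by rewrite -addnA mod_digit in xm; lia.
  subst y; case/positionP: x yN => [b|b|b i im|b i im] yN.
  + by rewrite -addn1 elim_Sl ?inE ?addn1 ?eqxx//; lia.
  + by rewrite -addn1 elim_Sr ?inE ?addn1 /= ?eqxx ?orbT//; lia.
  + have [im1|im1] : i.+1 = m \/ (i.+1 < m)%N by lia.
      by rewrite -addnS im1 orbC elim_Sl// !inE eqxx !orbT.
    by rewrite -addnS elim_Sl ?inE ?addnS ?eqxx//; lia.
  + have [im1|im1] : i.+1 = m \/ (i.+1 < m)%N by lia.
      have -> : ((b * q + m + i).+1 = b.+1 * q)%N by lia.
      by rewrite orbC elim_Sr// !inE eqxx !orbT.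
    by rewrite -addnS elim_Sr ?inE ?addnS /= ?eqxx ?orbT//; lia.
Qed.

End EliminationStep.

Lemma elimination_exists m L : (1 < m)%N ->
  exists S p r K, elimination m L S p r K.
Proof.
move=> m1; elim: L => [|L [S [p [r [K H]]]]]; last first.
  by do 4 eexists; apply: elimination_step H.
(* For L = 0 the range is [0, 1]: 1 is eliminated first, with parent 0. *)
exists (fun x => if x == 1%N then [:: 0%N] else [::]), (fun=> 0%N), id, 2%N.
split=> //.
- by move=> x; case: ifP.
- by move=> x /andP[].
- by move=> x u /andP[]; case: x => [|[|x]]//= _ _; rewrite inE => /eqP ->; left.
- move=> x y; rewrite expn0 => y1 [yx|[]//]; have x0 : x = 0%N by lia.
  by rewrite yx x0.
Qed.

(** * The host graph and its treewidth *)

Definition host_edges (m J n : nat) : {set {set 'I_n}} :=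
  [set edge z.1 z.2 | z in [pred z : 'I_n * 'I_n | host_rel m J z.1 z.2]]%SET.

Lemma host_edgesP m J n (e : {set 'I_n}) :
  reflect (exists x y : 'I_n, host_rel m J x y /\ e = edge x y) (e \in host_edges m J n).
Proof.
apply: (iffP imsetP) => [[[x y] /= h ->]|[x [y [h ->]]]]; first by exists x, y.
by exists (x, y).
Qed.

Lemma treewidth_host m J n : (1 < m)%N -> (treewidth (host_edges m J n) <= 4)%N.
Proof.
(* This L is at least J, to cover all chord levels, and makes (2m)^L at least n, to cover all
   vertices. *)
move=> m1; pose L := (J + n)%N; pose N := ((2 * m) ^ L)%N.
have [S [p [r [K H]]]] := elimination_exists L m1.
have nN : (n <= N)%N.
  have q1 : (1 < 2 * m)%N by lia.
  by apply: leq_trans (ltnW (ltn_expl n q1)) _; rewrite leq_exp2l// leq_addl.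
pose P (i : 'I_N.+1) : 'I_N.+1 := inord (p i).
have pos (i : 'I_N.+1) : i != ord0 -> (0 < i <= N)%N.
  by move=> i0; rewrite lt0n [(i <= N)%N]leq_ord andbT.
have PE i : i != ord0 -> (P i : nat) = p i.
  by move=> i0; rewrite inordK// ltnS (elim_parent_le H)// pos.
pose B (i : 'I_N.+1) := [set v : 'I_n | (v : nat) \in (i : nat) :: S i]%SET.
pose top (v : 'I_n) : 'I_N.+1 := inord v.
have topE v : (top v : nat) = v by rewrite inordK// ltnS (leq_trans (ltnW (ltn_ord v))).
apply: (@treewidth_parent _ _ _ P (fun i => r i) ord0 B top).
- by move=> i i0; rewrite PE// (elim_rank_lt H)// pos.
- by move=> v; rewrite inE topE mem_head.
- move=> v i; rewrite inE => /predU1P[vi /eqP[]|vS _].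
    by apply: val_inj; rewrite /= topE.
  have i0 : i != ord0.
    by apply: contraTneq vS => ->; rewrite (elim_root H).
  split=> //; rewrite inE PE//.
  by have [->|] := elim_clique H (pos _ i0) vS; rewrite !inE ?eqxx// => ->; rewrite orbT.
- move=> e /host_edgesP[x [y [xy ->]]].
  have : ((x : nat) \in S y) || ((y : nat) \in S x).
    apply: (elim_edge H); first exact: leq_trans (ltnW (ltn_ord y)) nN.
    case/orP: xy => [/eqP|/existsP[j jc]]; first by left.
    by right; exists j => //; apply: leq_trans (ltn_ord j) (leq_addr _ _).
  case/orP=> h; [exists (top y)|exists (top x)]; apply/fintype.subsetP=> z;
    by rewrite !inE topE => /orP[] /eqP ->; rewrite ?eqxx ?h ?orbT.
- move=> i; rewrite cardE -(size_map val).
  apply: leq_trans (_ : size ((i : nat) :: S i) <= _)%N; last first.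
    by rewrite /= ltnS (elim_size H).
  apply: uniq_leq_size; first by rewrite (map_inj_uniq val_inj) enum_uniq.
  by move=> x /mapP[v]; rewrite mem_enum inE => vB ->.
Qed.

(** * Spans of edges and their levels *)

(** Weights are functions of unordered pairs, so the span has to be recovered from the set;
    truncated subtraction discards the wrong order. *)
Definition span (n : nat) (e : {set 'I_n}) : nat :=
  (\max_(x in e) \max_(y in e) (x - y))%N.

Lemma span_edge n (x y : 'I_n) : (x <= y)%N -> span (edge x y) = (y - x)%N.
Proof.
move=> xy; apply/eqP; rewrite eqn_leq; apply/andP; split.
  apply/bigmax_leqP=> a aE; apply/bigmax_leqP=> b bE.
  by move: aE bE; rewrite !inE => /orP[] /eqP -> /orP[] /eqP ->; lia.
apply: (bigop.bigmax_sup y); first by rewrite !inE eqxx orbT.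
by apply: (bigop.bigmax_sup x); first by rewrite !inE eqxx.
Qed.

(* The span 1 of path edges has level 0, the span m(2m)^j of chords has level
   j + 1: multiplying by 2 makes the latter an exact power of 2m. *)
Definition level (m d : nat) : nat := trunc_log (2 * m) (2 * d).

Lemma level1 m : (1 < m)%N -> level m 1 = 0%N.
Proof. by move=> m1; apply: trunc_log_eq; rewrite ?expn0 ?expn1; lia. Qed.

Lemma level_chord m j : (1 < m)%N -> level m (m * (2 * m) ^ j) = j.+1.
Proof. by move=> m1; rewrite /level mulnA -expnS trunc_expnK//; lia. Qed.

Lemma host_rel_lt m J x y : (0 < m)%N -> host_rel m J x y -> (x < y)%N.
Proof.
move=> m0 /orP[/eqP ->//|/existsP[j /and3P[_ _ /eqP ->]]].
by rewrite -{1}[x]addn0 ltn_add2l muln_gt0 m0 expn_gt0 muln_gt0 m0.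
Qed.

(** * Weights of path edges and chords *)

Section HostGraph.
Variables (R : realType) (eps : R) (m J n : nat).
Hypotheses (eps_gt0 : 0 < eps) (eps_lt1 : eps < 1).
Hypotheses (m_gt2 : (2 < m)%N) (m_eps : eps * m%:R <= 2 + 2 * eps).
Hypotheses (J_eps : eps * J%:R <= 1) (J_eps1 : eps * J.-1%:R < 2^-1).

Let q := (2 * m)%N.
Let q_gt1 : (1 < q)%N. Proof. by rewrite /q; lia. Qed.
Let m_gt1 : (1 < m)%N. Proof. exact: ltnW. Qed.
Let m_gt0 : (0 < m)%N. Proof. exact: ltnW. Qed.

Definition shrink (j : nat) : R := (1 + 2 * eps * j%:R)^-1.
Definition host_weight (d : nat) : R := d%:R * shrink (level m d).
Definition chord_weight (j : nat) : R := (m * q ^ j)%:R * shrink j.+1.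

Let den_gt0 j : 0 < 1 + 2 * eps * j%:R :> R.
Proof. by rewrite ltr_pwDl// mulr_ge0// mulr_ge0// ltW. Qed.

Lemma shrink_gt0 j : 0 < shrink j. Proof. by rewrite invr_gt0. Qed.

Lemma shrink_le i j : (i <= j)%N -> shrink j <= shrink i.
Proof.
move=> ij; rewrite lef_pV2 ?posrE// lerD2l ler_wpM2l ?ler_nat//.
by rewrite mulr_ge0// ltW.
Qed.

(** After clearing denominators this says 2 eps j < 1, which [J_eps1] gives for j up to J - 1. *)
Lemma shrink_lt j : (j < J)%N -> (1 + eps) * shrink j.+1 < shrink j.
Proof.
move=> jJ.
have ej : eps * j%:R < 2^-1.
  by apply: le_lt_trans J_eps1; rewrite ler_pM2l// ler_nat; lia.
rewrite /shrink ltr_pdivrMr// mulrC ltr_pdivlMr//.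
have : 0 < eps * (2^-1 - eps * j%:R) by rewrite mulr_gt0// subr_gt0.
by rewrite -[j.+1%:R]natr1; move: j%:R ej => z ej; nra.
Qed.

Lemma host_weight1 : host_weight 1 = 1.
Proof. by rewrite /host_weight level1// /shrink mulr0 addr0 invr1 mulr1. Qed.

Lemma host_weight_chord j : host_weight (m * q ^ j) = chord_weight j.
Proof. by rewrite /host_weight level_chord. Qed.

Lemma chord_weight_gt0 j : 0 < chord_weight j.
Proof. by rewrite mulr_gt0 ?shrink_gt0// ltr0n muln_gt0 m_gt0 expn_gt0 ltnW. Qed.

(** Each level multiplies the span by q, at least 4, and the shrink factor by at least 1/2. *)
Lemma chord_weight_double i j : (j < i)%N -> 2 * chord_weight j <= chord_weight i.
Proof.
have S k : 2 * chord_weight k <= chord_weight k.+1.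
  rewrite /chord_weight /shrink expnS mulnCA [(q * _)%:R]natrM.
  set a : R := (m * q ^ k)%:R.
  have a0 : 0 <= a by rewrite ler0n.
  have q4 : (4 : R) <= q%:R by rewrite ler_nat /q; lia.
  rewrite ler_pdivlMr//.
  rewrite [leLHS](_ : _ = 2 * (1 + 2 * eps * k.+2%:R) / (1 + 2 * eps * k.+1%:R) * a); last by ring.
  rewrite ler_wpM2r// ler_pdivrMr//.
  have k0 : 0 <= eps * k%:R by rewrite mulr_ge0// ltW.
  apply: le_trans (_ : 4 * (1 + 2 * eps * k.+1%:R) <= _); last by rewrite ler_wpM2r// ltW.
  by rewrite -[k.+2%:R]natr1 -[k.+1%:R]natr1; lra.
elim: i => // i IH; rewrite ltnS leq_eqVlt => /predU1P[->//|/IH h].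
apply: le_trans h (le_trans _ (S i)).
by rewrite ler_peMl ?ltW ?chord_weight_gt0// ltr1n.
Qed.

Lemma chord_weight_ge j : (j < J)%N -> (m * q ^ j)%:R / 3 <= chord_weight j.
Proof.
move=> jJ; rewrite ler_wpM2l// lef_pV2 ?posrE//.
have : eps * j.+1%:R <= 1 by apply: le_trans J_eps; rewrite ler_pM2l// ler_nat.
by lra.
Qed.

(** The span is at least m, hence at least 3, which makes up for the factor 1/3; no chord is then
    lighter than a path edge. *)
Lemma chord_weight_ge1 j : (j < J)%N -> 1 <= chord_weight j.
Proof.
move/chord_weight_ge; apply: le_trans.
rewrite ler_pdivlMr// mul1r ler_nat; apply: (leq_trans m_gt2).
by rewrite leq_pmulr// expn_gt0 ltnW.
Qed.

Definition host_wt (e : {set 'I_n}) : R := host_weight (span e).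

Lemma host_simple : edge_set (host_edges m J n).
Proof.
move=> e /host_edgesP[x [y [/(host_rel_lt m_gt0) xy ->]]].
by rewrite cards2; case: eqP xy => // ->; rewrite ltnn.
Qed.

Variant host_edge_spec (x y : 'I_n) : nat -> R -> Prop :=
| HostPath of y = x.+1 :> nat : host_edge_spec x y 1 1
| HostChord j of (j < J)%N & chord m j x y :
    host_edge_spec x y (m * q ^ j) (chord_weight j).

Lemma host_relP (x y : 'I_n) : host_rel m J x y ->
  host_edge_spec x y (y - x) (host_wt (edge x y)).
Proof.
move=> h; rewrite /host_wt span_edge; last exact: ltnW (host_rel_lt m_gt0 h).
case/orP: h => [/eqP yx|/existsP[j c]].
  by rewrite yx subSnn host_weight1; constructor.
have /and3P[_ _ /eqP yx] := c.
rewrite yx addKn -/q host_weight_chord; exact: HostChord.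
Qed.

Lemma host_wt_ge1 e : e \in host_edges m J n -> 1 <= host_wt e.
Proof.
case/host_edgesP=> x [y [/host_relP h ->]]; case: h => // j jJ _.
exact: chord_weight_ge1.
Qed.

Lemma host_wt_gt0 e : e \in host_edges m J n -> 0 < host_wt e.
Proof. by move/host_wt_ge1; apply: lt_le_trans. Qed.

Definition host : wgraph R 'I_n := WGraph host_simple host_wt_gt0.

(** * Weights of walks compared with a level [j] chord *)

Let gap (a b : 'I_n) : R := `|a%:R - b%:R|.

Let gapC a b : gap a b = gap b a. Proof. by rewrite /gap distrC. Qed.

Let gap_tri a b c : gap a c <= gap a b + gap b c.
Proof. exact: ler_distD. Qed.

Let gap_ge0 a b : 0 <= gap a b. Proof. exact: normr_ge0. Qed.

Let gapE (x y : 'I_n) : (x <= y)%N -> gap x y = (y - x)%:R.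
Proof. by move=> xy; rewrite gapC /gap -natrB// normr_nat. Qed.

Definition chord_sym j (x y : nat) : bool := chord m j x y || chord m j y x.

Lemma host_adjP j (a b : 'I_n) : adj (host_edges m J n) a b ->
  [\/ 2 * chord_weight j <= host_wt (edge a b),
      shrink j * gap a b <= host_wt (edge a b)
    | chord_sym j a b /\ host_wt (edge a b) = chord_weight j].
Proof.
have main (x y : 'I_n) : host_rel m J x y ->
    [\/ 2 * chord_weight j <= host_wt (edge x y),
        shrink j * gap x y <= host_wt (edge x y)
      | chord m j x y /\ host_wt (edge x y) = chord_weight j].
  move=> h; rewrite gapE; last exact: ltnW (host_rel_lt m_gt0 h).
  case: (host_relP h) => [_|i _ c].
    apply: Or32; rewrite mulr1; apply: le_trans (shrink_le (leq0n j)) _.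
    by rewrite /shrink mulr0 addr0 invr1.
  case: (ltngtP i j) c => [ij|ji|->] c.
  - apply: Or32; rewrite mulrC; apply: ler_wpM2l; rewrite ?ler0n//.
    exact: shrink_le.
  - by apply: Or31; apply: chord_weight_double.
  - exact: Or33.
case/host_edgesP=> x [y [/main h /eq_edge[] [-> ->]]]; last rewrite edgeC gapC.
  by case: h => [h|h|[c h]]; [apply: Or31|apply: Or32|apply: Or33; rewrite /chord_sym c].
by case: h => [h|h|[c h]];
  [apply: Or31|apply: Or32|apply: Or33; rewrite /chord_sym c orbT].
Qed.

Section Walk.
Variables (j : nat) (H : {set {set 'I_n}}).
Hypothesis (HE : H \subset host_edges m J n).

(* A walk either is as expensive as two level-[j] chords, or uses none of them
   and gains only the factor [shrink j] of the lower levels, or uses exactly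
   one, [x -> y]. *)
Definition walk_bound (a b : 'I_n) (w : R) : Prop :=
  [\/ 2 * chord_weight j <= w, shrink j * gap a b <= w
    | exists x y, [/\ adj H x y, chord_sym j x y
        & chord_weight j + shrink j * (gap a x + gap y b) <= w]].

Lemma walk_bound_ge0 a b w : walk_bound a b w -> 0 <= w.
Proof.
have w0 := chord_weight_gt0 j; have s0 := shrink_gt0 j.
case=> [|h|[x [y [_ _ h]]]]; first by apply: le_trans; rewrite mulr_ge0// ltW.
  by apply: le_trans h; rewrite mulr_ge0// ltW.
by apply: le_trans h; apply: addr_ge0 (ltW w0) (mulr_ge0 (ltW s0) (addr_ge0 _ _)).
Qed.

(** Induction on the walk: a lower edge in front is absorbed by the triangle inequality, a second
    level [j] chord or any higher one leads to the first case. *)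
Lemma walk_boundP (a : 'I_n) s : path (adj H) a s ->
  walk_bound a (last a s) (\sum_(e <- pairmap (@edge _) a s) host_wt e).
Proof.
have w0 := chord_weight_gt0 j; have s0 := shrink_gt0 j.
elim: s a => [|b s IH] a /=.
  by move=> _; apply: Or32; rewrite big_nil /gap subrr normr0 mulr0.
case/andP=> ab /IH {}IH; have w1 := walk_bound_ge0 IH.
rewrite big_cons; set w := \sum_(e <- _) _ in IH w1 *; set c := last b s in IH *.
have abE : adj (host_edges m J n) a b by apply: fintype.subsetP HE _ ab.
case: (host_adjP j abE) => [h|h|[ch ->]].
- by apply: Or31; apply: le_trans h _; rewrite lerDl.
- case: IH => [h2|h2|[x [y [xy cxy h2]]]].
  + apply: Or31; apply: le_trans h2 _; rewrite lerDr.
    by apply: le_trans h; rewrite mulr_ge0// ltW.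
  + apply: Or32; apply: le_trans (lerD h h2).
    by rewrite -mulrDr ler_wpM2l ?gap_tri// ltW.
  + apply: Or33; exists x, y; split=> //; apply: le_trans (lerD h h2).
    rewrite addrCA lerD2l -mulrDr; apply: ler_wpM2l; first exact: ltW.
    rewrite addrA lerD2r; exact: gap_tri.
- case: IH => [h2|h2|[x [y [xy cxy h2]]]].
  + by apply: Or31; apply: le_trans h2 _; rewrite lerDr ltW.
  + by apply: Or33; exists a, b; split=> //; rewrite lerD2l /gap subrr normr0 add0r.
  + apply: Or31; rewrite mulr2n mulrDl !mul1r lerD2l; apply: le_trans h2.
    by rewrite lerDl; apply: mulr_ge0 (ltW s0) (addr_ge0 _ _).
Qed.

End Walk.

(** * Every spanner contains all chords *)

Let gap_dvd u (x y : 'I_n) : (u %| x)%N -> (u %| y)%N -> x != y -> u%:R <= gap x y.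
Proof.
have main (a b : 'I_n) : (u %| a)%N -> (u %| b)%N -> (a < b)%N -> u%:R <= gap a b.
  move=> ua ub ab; rewrite gapE ?ler_nat; last exact: ltnW.
  by apply: dvdn_leq; [rewrite subn_gt0 | apply: dvdn_sub].
move=> ux uy; rewrite -val_eqE neq_ltn => /orP[|] xy; first exact: main.
by rewrite gapC; apply: main.
Qed.

(* Another level-[j] chord is shifted by at least [q ^ j], a distance that has to
   be travelled at both of its ends; traversed backwards it is even worse. *)
Lemma chord_sep j (x y a b : 'I_n) : chord m j x y -> chord_sym j a b ->
  edge a b != edge x y -> 2 * (q ^ j)%:R <= gap x a + gap b y.
Proof.
case/and3P=> ux _ /eqP yE; set u := ((2 * m) ^ j)%N in ux yE.
have uy : (u %| y)%N by rewrite yE dvdn_add// dvdn_mull.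
rewrite mulr2n mulrDl mul1r; case/orP=> /and3P[ua _ /eqP aE] ne.
  have ax : a != x.
    apply: contraNneq ne => ax; rewrite ax.
    by rewrite (_ : b = y)//; apply: val_inj; rewrite /= aE yE ax.
  have by_ : b != y.
    apply: contraNneq ax => b_y; apply/eqP/val_inj => /=.
    by apply: (@addIn (m * u)); rewrite -aE -yE b_y.
  have ub : (u %| b)%N by rewrite aE dvdn_add// dvdn_mull.
  by rewrite lerD// gap_dvd// eq_sym.
apply: le_trans (_ : (a%:R - x%:R) + (y%:R - b%:R) <= _); last first.
  by rewrite lerD// ?[gap x a]gapC ?[gap b y]gapC ler_norm.
rewrite aE yE !natrD -/u -/q.
have : u%:R <= (m * u)%:R :> R by rewrite ler_nat leq_pmull.
rewrite /u -/q; lra.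
Qed.

Lemma spanner_chord j H (x y : 'I_n) :
  spanner host eps H -> (j < J)%N -> chord m j x y -> edge x y \in H.
Proof.
move=> [HE Hd] jJ c; apply/negPn/negP => xyH.
have w0 := chord_weight_gt0 j; have s0 := shrink_gt0 j.
have xy : host_rel m J x y by apply/orP; right; apply/existsP; exists (Ordinal jJ).
have xyE : host_wt (edge x y) = chord_weight j.
  have /and3P[_ _ /eqP yE] := c.
  by rewrite /host_wt span_edge yE ?leq_addr// addKn -/q host_weight_chord.
have gxy : gap x y = (m * q ^ j)%:R.
  by have /and3P[_ _ /eqP yE] := c; rewrite gapE yE ?leq_addr// addKn.
(* A lower bound for walks from x to y in H: the terms are the cases of [walk_bound], with
   [chord_sep] applied in the last one, as the chord used there is in H and so differs from the
   missing one. *)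
pose T := Num.min (2 * chord_weight j) (Num.min (shrink j * gap x y)
   (chord_weight j + shrink j * (2 * (q ^ j)%:R))).
have TH : (T%:E <= dist host H x y)%E.
  apply: le_ereal_inf_tmp => _ [s /andP[sp /eqP sl] <-]; rewrite lee_fin.
  have := walk_boundP j HE sp; rewrite sl => -[h|h|[a [b [ab cab h]]]].
  - by rewrite !ge_min h.
  - by rewrite !ge_min h orbT.
  - rewrite !ge_min; apply/orP; right; apply/orP; right; apply: le_trans h.
    rewrite lerD2l; apply: ler_wpM2l (ltW s0) _ _ _; apply: chord_sep => //.
    by apply: contraNneq xyH => <-.
have dE : (dist host (edges host) x y <= (chord_weight j)%:E)%E.
  apply: ereal_inf_lbound; exists [:: y].
    rewrite /= eqxx !andbT; apply/host_edgesP; by exists x, y.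
  by rewrite /walk_weight /= big_seq1 xyE.
have e1 : 0 <= 1 + eps by rewrite addr_ge0// ltW.
have : (T%:E <= ((1 + eps) * chord_weight j)%:E)%E.
  apply: le_trans TH (le_trans (Hd x y) _).
  by rewrite EFinM lee_pmul2l// lte_fin ltr_pwDl// ltW.
have sl := shrink_lt jJ; have sp := shrink_gt0 j.+1.
have u0 : 0 < (q ^ j)%:R :> R by rewrite ltr0n expn_gt0 ltnW.
have mu0 : 0 < (m * q ^ j)%:R :> R by rewrite natrM mulr_gt0// ltr0n.
(* Each term exceeds (1 + eps) times the chord weight: the first as eps < 1, the second by
   [shrink_lt], the third by [m_eps] and [shrink_lt]. *)
apply/negP; rewrite lee_fin -ltNge !lt_min; apply/and3P; split.
- by rewrite ltr_pM2r// ltrD2l.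
- by rewrite gxy mulrC /chord_weight -mulrA mulrC ltr_pM2r// mulrC.
- rewrite mulrDl mul1r ltrD2l /chord_weight natrM mulrA mulrA.
  rewrite [ltRHS]mulrA -[ltLHS]mulrA [_ * shrink j.+1]mulrC mulrA ltr_pM2r//.
  apply: le_lt_trans (_ : 2 * ((1 + eps) * shrink j.+1) < _); last first.
    by rewrite [ltRHS]mulrC ltr_pM2l.
  rewrite mulrA; apply: ler_wpM2r; first exact: ltW.
  by rewrite mulrDr mulr1.
Qed.

(** * The minimum spanning tree and the lightness of spanners *)

Section Lightness.
Variable root : 'I_n.
Hypothesis root0 : root = 0%N :> nat.

Let prev (i : 'I_n) : 'I_n := insubd i i.-1.

Let prevE i : prev i = i.-1 :> nat.
Proof. by rewrite val_insubd (leq_ltn_trans (leq_pred i)). Qed.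

Let gt0 (i : 'I_n) : i != root -> (0 < i)%N.
Proof. by rewrite -val_eqE /= root0 lt0n. Qed.

Definition host_path : {set {set 'I_n}} := parent_edges prev root.

Lemma host_path_wt e : e \in host_path -> host_wt e = 1.
Proof.
case/imsetP=> i; rewrite !inE => /gt0 i0 ->.
by rewrite edgeC /host_wt span_edge prevE ?leq_pred// -subn1 subKn// host_weight1.
Qed.

Lemma weight_host_path : weight host host_path = #|host_path|%:R.
Proof.
by rewrite /weight (eq_bigr (fun=> 1)) => [|e /host_path_wt//]; rewrite sumr_const.
Qed.

Lemma card_host_path : (#|host_path| <= n.-1)%N.
Proof. by rewrite -[n in n.-1]card_ord -(cardsC1 root) leq_imset_card. Qed.

Lemma host_path_tree : tree host_path.
Proof.
by apply: (@parent_tree _ prev (fun i => i)) => i /gt0 i0; rewrite prevE prednK.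
Qed.

Lemma host_path_spanning : spanning_tree host host_path.
Proof.
split; last exact: host_path_tree.
apply/fintype.subsetP=> e /imsetP[i]; rewrite !inE => /gt0 i0 ->.
apply/host_edgesP; exists (prev i), i; split; last by rewrite edgeC.
by rewrite /host_rel prevE prednK// eqxx.
Qed.

(** Every edge weighs at least 1 and a spanning tree has at least n - 1 edges; the unit path attains
    both bounds. *)
Lemma host_path_mst : minimum_spanning_tree host host_path.
Proof.
split; first exact: host_path_spanning.
move=> M [ME [_ Mc _]]; rewrite weight_host_path.
apply: le_trans (_ : #|M|%:R <= _).
  rewrite ler_nat; apply: leq_trans card_host_path _.
  by have := connected_card Mc; rewrite card_ord; lia.
rewrite -sumr_const; apply: ler_sum => e eM.
by apply: host_wt_ge1; apply: fintype.subsetP ME _ eM.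
Qed.

Lemma card_chords j H : spanner host eps H -> (j < J)%N ->
  (n %/ q ^ j.+1 * m <= #|[set e in H | span e == (m * q ^ j)%N]%SET|)%N.
Proof.
move=> HS jJ; set b := (n %/ _)%N; set u := (q ^ j)%N.
have u0 : (0 < u)%N by rewrite expn_gt0 ltnW.
(* The left end of a chord: division point [z.2] of the complete block [z.1] of length q^(j+1). *)
pose X (z : 'I_b * 'I_m) : nat := ((z.1 * q + z.2) * u)%N.
have Xn z : (X z + m * u < n)%N.
  apply: leq_trans (leq_divM n (q ^ j.+1)); rewrite -/b expnS -/u /X -mulnDl mulnA.
  rewrite ltn_pmul2r//; apply: leq_trans (_ : z.1.+1 * q <= _)%N.
    by rewrite mulSn /q; have := ltn_ord z.2; lia.
  by rewrite leq_mul2r ltn_ord orbT.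
have XnE z : (X z < n)%N by apply: leq_ltn_trans (Xn z); apply: leq_addr.
pose f z : {set 'I_n} := edge (Ordinal (XnE z)) (Ordinal (Xn z)).
have f_inj : injective f.
  move=> z w /eq_edge[[/(congr1 val) /= h _]|[/(congr1 val) /= h /(congr1 val) /= h']]; last first.
    by have := muln_gt0 m u; rewrite m_gt0 u0; lia.
  move/eqP: h; rewrite eqn_pmul2r// => /eqP h.
  have zq (y : 'I_b * 'I_m) : (y.2 < q)%N by apply: leq_trans (ltn_ord _) _; rewrite /q; lia.
  have q0 : (0 < q)%N by exact: ltnW.
  have h1 := congr1 (divn^~ q) h; have h2 := congr1 (modn^~ q) h.
  rewrite /= !divnMDl// !divn_small// !addn0 in h1.
  rewrite /= !modnMDl !modn_small// in h2.
  by case: z w h1 h2 {h} => z1 z2 [w1 w2] /= /val_inj -> /val_inj ->.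
apply: leq_trans (_ : #|[set f z | z in predT]%SET| <= _)%N.
  by rewrite card_imset// card_prod !card_ord.
apply: subset_leq_card; apply/fintype.subsetP=> e /imsetP[z _ ->]; rewrite inE.
rewrite span_edge /= ?leq_addr// addKn eqxx andbT.
apply: (spanner_chord HS jJ); apply/and3P; split=> //=; first by rewrite dvdn_mull.
rewrite mulnK// -/q modnMDl modn_small ?ltn_ord//.
by apply: leq_trans (ltn_ord _) _; rewrite /q; lia.
Qed.

(** Spans of different levels differ, so each edge is counted at most once. *)
Lemma weight_by_chords (H : {set {set 'I_n}}) : H \subset host_edges m J n ->
  \sum_(j < J) #|[set e in H | span e == (m * q ^ j)%N]%SET|%:R * chord_weight j
    <= weight host H.
Proof.
move=> HE.
rewrite (eq_bigr (fun j : 'I_J => \sum_(e in H)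
    if span e == (m * q ^ j)%N then chord_weight j else 0)); last first.
  move=> j _; rewrite mulr_natl -sumr_const -big_mkcondr.
  by apply: eq_bigl => e; rewrite inE.
rewrite exchange_big; apply: ler_sum => e eH /=.
have [/existsP[j /eqP sj]|] := boolP [exists j : 'I_J, span e == (m * q ^ j)%N].
  rewrite (bigD1 j)//= big1 => [|i ij].
    by rewrite sj eqxx addr0 /host_wt sj host_weight_chord.
  rewrite sj eqn_pmul2l// eqn_exp2l//; case: ifP => // /eqP/val_inj ji.
  by rewrite ji eqxx in ij.
rewrite negb_exists => /forallP h; rewrite big1 => [|j _].
  by rewrite ltW// host_wt_gt0//; apply: fintype.subsetP HE _ eH.
by rewrite (negPf (h j)).
Qed.

Lemma host_lightness H : (0 < J)%N -> (q ^ J <= n)%N -> spanner host eps H ->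
  J%:R * m%:R / 12 <= lightness host host_path H.
Proof.
move=> J0 qn HS.
have n1 : (1 < n)%N.
  by apply: leq_trans qn; rewrite -[1%N](expn0 q) ltn_exp2l.
have M0 : (0 < #|host_path|)%N.
  by have [_ /connected_card] := host_path_tree; rewrite card_ord; lia.
have Mn : (#|host_path| <= n)%N := leq_trans card_host_path (leq_pred n).
rewrite /lightness weight_host_path ler_pdivlMr ?ltr0n//.
apply: le_trans (weight_by_chords (proj1 HS)).
(* Each level contributes b m chords of weight at least m q^j / 3, in total m b q^(j+1) / 6. *)
apply: le_trans (_ : \sum_(j < J) m%:R * n%:R / 12 <= _).
  rewrite sumr_const card_ord -[leRHS]mulr_natl.
  rewrite [leRHS](_ : _ = J%:R * m%:R / 12 * n%:R); last by ring.
  by apply: ler_wpM2l; [rewrite divr_ge0// mulr_ge0 | rewrite ler_nat].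
apply: ler_sum => j _; have jJ := ltn_ord j.
set b := (n %/ q ^ j.+1)%N.
have b1 : (0 < b)%N.
  rewrite divn_gt0 ?expn_gt0 ?(ltnW q_gt1)//; apply: leq_trans qn.
  by rewrite leq_exp2l.
(* As q^(j+1) <= n, rounding n down to a multiple of it loses at most half. *)
have nb : (n <= 2 * (b * q ^ j.+1))%N.
  have qj : (0 < q ^ j.+1)%N by rewrite expn_gt0 (ltnW q_gt1).
  have := ltn_ceil n qj; rewrite -/b mulSn.
  have : (q ^ j.+1 <= b * q ^ j.+1)%N by rewrite leq_pmull.
  by move: (b * q ^ j.+1)%N (q ^ j.+1)%N => x y; lia.
apply: le_trans (_ : (b * m)%:R * ((m * q ^ j)%:R / 3) <= _); last first.
  apply: ler_pM; rewrite ?divr_ge0 ?ler0n ?chord_weight_ge// ler_nat.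
  exact: card_chords.
have -> : (b * m)%:R * ((m * q ^ j)%:R / 3) = m%:R * (2 * (b * q ^ j.+1))%:R / 12 :> R.
  by rewrite expnS /q !natrM; field.
by rewrite ler_pM2r ?invr_gt0// ler_wpM2l// ler_nat.
Qed.
End Lightness.
End HostGraph.

(** * Choice of the parameters *)

(** This ensures (2m)^J <= n for m = k + 2, J = [uphalf k] and x = 1/eps. If k >= 2, then 2(k + 2)
    <= 4x <= x^4; the factor 6 is the left side at k = 1. *)
Lemma level_base_bound (R : realType) (x : R) (k : nat) :
  (0 < k)%N -> k%:R <= x ->
  ((2 * (k + 2)) ^ uphalf k)%:R <= 6 * x `^ (4 * x).
Proof.
move=> k0 kx.
have x1 : 1 <= x by apply: le_trans kx; rewrite ler1n.
have x0 : 0 <= x by apply: le_trans x1.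
apply: le_trans (_ : 6 * x ^+ (4 * uphalf k) <= _); last first.
  rewrite ler_pM2l// -powR_mulrn// ler_powR// natrM ler_pM2l//.
  by apply: le_trans kx; rewrite ler_nat; lia.
have [k1|k2] : k = 1%N \/ (2 <= k)%N by lia.
  by rewrite k1 /= ler_peMr// exprn_ege1.
apply: le_trans (_ : x ^+ (4 * uphalf k) <= _); last by rewrite ler_peMl ?ler1n// exprn_ge0.
rewrite exprM natrX lerXn2r ?nnegrE ?exprn_ge0//.
have x2 : 2 <= x by apply: le_trans kx; rewrite ler_nat.
rewrite natrM natrD.
apply: le_trans (_ : 4 * x <= _); first by lra.
have x4 : 4 <= x ^+ 2 by rewrite expr2; nra.
have -> : x ^+ 4 = x ^+ 2 * x * x by ring.
by rewrite -mulrA; apply: ler_pM => //; nra.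
Qed.

Theorem theorem4p1 (R : realType) :
  exists C a c : R, [/\ 0 < C, 0 < a & 0 < c] /\
    forall eps : R, 0 < eps -> eps < 1 ->
    forall n : nat, C * eps^-1 `^ (a / eps) <= n%:R ->
    exists (G : wgraph R 'I_n) (M : {set {set 'I_n}}),
      [/\ (treewidth (edges G) <= 4)%N,
          minimum_spanning_tree G M &
          forall H : {set {set 'I_n}}, spanner G eps H ->
            c / eps ^+ 2 <= lightness G M H].
Proof.
(* 6 and 4 come from [level_base_bound]. With J >= k/2, m >= k and k >= x/2, the bound J m / 12 is
   at least x^2 / 96. *)
exists 6, 4, 96^-1; split=> // eps e0 e1 n hn.
set x := eps^-1 in hn.
have x1 : 1 < x by rewrite invf_gt1.
have x0 : 0 < x by apply: lt_trans x1.
(* k is the integer part of 1/eps. The summand 2 in m = k + 2 keeps m at least 3 when k = 1. *)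
have [k k0 /andP[kx xk]] : exists2 k, (0 < k)%N & k%:R <= x < k.+1%:R.
  exists (Num.truncn x); first by rewrite truncn_ge_nat ltW.
  exact: truncn_itv (ltW x0).
have ek : eps * k%:R <= 1 by rewrite mulrC -ler_pdivlMr// mul1r.
have J2 : 2 * (uphalf k)%:R <= k%:R + 1 :> R by rewrite -natrM natr1 ler_nat; lia.
have J3 : k%:R <= 2 * (uphalf k)%:R :> R by rewrite -natrM ler_nat; lia.
have J1 : 2 * ((uphalf k).-1)%:R <= k%:R - 1 :> R.
  by rewrite lerBrDr -natrM natr1 ler_nat; lia.
have m3 : (2 < k + 2)%N by rewrite addn2.
have hm : eps * (k + 2)%:R <= 2 + 2 * eps by rewrite natrD mulrDr; lra.
have hJ : eps * (uphalf k)%:R <= 1.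
  by have := ler_wpM2l (ltW e0) J2; lra.
have hJ1 : eps * (uphalf k).-1%:R < 2^-1.
  by have := ler_wpM2l (ltW e0) J1; lra.
have qn : ((2 * (k + 2)) ^ uphalf k <= n)%N.
  by rewrite -(ler_nat R); apply: le_trans hn; apply: level_base_bound.
have n0 : (0 < n)%N by apply: leq_trans qn; rewrite expn_gt0 muln_gt0 addn2.
exists (host n e0 e1 m3 hm hJ hJ1), (host_path (Ordinal n0)).
split; first by apply: treewidth_host; rewrite addn2.
  exact: host_path_mst.
move=> H HS.
have J0 : (0 < uphalf k)%N by case: (k) k0.
apply: le_trans _ (host_lightness _ J0 qn HS) => //.
have -> : 96^-1 / eps ^+ 2 = 96^-1 * x ^+ 2 by rewrite exprVn.
have k1 : 1 <= k%:R :> R by rewrite ler1n.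
have xk2 : x <= 2 * k%:R by rewrite -natr1 in xk; lra.
have xx : x * x <= (2 * k%:R) * (2 * k%:R) by apply: ler_pM => //; apply: ltW.
have kJ : k%:R * k%:R <= (2 * (uphalf k)%:R) * (k + 2)%:R :> R.
  by apply: ler_pM => //; rewrite ler_nat leq_addr.
by rewrite expr2; lra.
Qed.
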